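(* Let $\lambda$ be a partition with $\ell(\lambda)$ nonzero parts, let $h=\operatorname{Diag}(h_1,\dots,h_N)$, and suppose that $z_1,\dots,z_n$ are real. (i) If $h_1,\dots,h_N\ge0$, then $T_\lambda(t)$ is positive semidefinite for every real $t$ with $t\ge -z_k$ for all $1\le k\le n$. (ii) If $h_1,\dots,h_N\ge0$ and at least $\ell(\lambda)$ of the values $h_i$ are strictly positive (in particular, if $h_1,\dots,h_N>0$ and $\ell(\lambda)\le N$), then $T_\lambda(t)$ is positive definite for every real $t$ with $t>-z_k$ for all $1\le k\le n$.
   Context: Positive (semi)definiteness is with respect to the standard Hermitian inner product on $(\mathbb{C}^N)^{\otimes n}$. $[n]=\{1,\dots,n\}$; $E_{i,j}\in\operatorname{End}(\mathbb{C}^N)$ denotes the matrix unit, and $A^{(k)}$ denotes $A\in\operatorname{End}(\mathbb{C}^N)$ acting in the $k$th tensor factor of $(\mathbb{C}^N)^{\otimes n}$. For a partition $\lambda$ and $X\in\operatorname{End}(\mathbb{C}^N)$, let $s_\lambda(X)$ be the Schur polynomial $s_\lambda(x_1,\dots,x_N)$ evaluated at the eigenvalues of $X$ (it is $0$ if $\ell(\lambda)>N$). For a polynomial function $f$ on $\operatorname{End}(\mathbb{C}^N)$ and $K\subseteq[n]$, define $$\mathsf{d}_Kf(h)=\sum_{(i_k,j_k)_{k\in K}\in([N]^2)^K}\Big(\prod_{k\in K}\partial_{\varepsilon_k}\Big)\Big|_{\varepsilon=0}f\Big(h+\sum_{k\in K}\varepsilon_kE_{j_k,i_k}\Big)\cdot\prod_{k\in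 K}E_{i_k,j_k}^{(k)}\in\operatorname{End}((\mathbb{C}^N)^{\otimes n}),$$ with $\mathsf{d}_\varnothing f(h)=f(h)\cdot\mathrm{Id}$. The higher Gaudin Hamiltonian is $$T_\lambda(u)=(u+z_1+\mathsf{d}_1)\cdots(u+z_n+\mathsf{d}_n)s_\lambda(h)=\sum_{K\subseteq[n]}\Big(\prod_{k\in[n]\setminus K}(u+z_k)\Big)\mathsf{d}_Ks_\lambda(h),$$ a polynomial in $u$ with coefficients in $\operatorname{End}((\mathbb{C}^N)^{\otimes n})$; $T_\lambda(t)$ is its value at $u=t$. *)

(* Defs.v *)
From HB Require Import structures.
From mathcomp Require Import all_boot all_order all_algebra.
From mathcomp Require Import complex.
From mathcomp Require Import all_classical all_reals all_analysis.

Set Implicit Arguments.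
Unset Strict Implicit.
Unset Printing Implicit Defensive.

Import Order.TTheory GRing.Theory Num.Theory.
Import numFieldNormedType.Exports.

Local Open Scope ring_scope.
Local Open Scope sesquilinear_scope.

(* Partitions are weakly decreasing sequences; trailing zeros are allowed. *)
Definition is_partition (la : seq nat) : bool := sorted geq la.

Definition nparts (la : seq nat) : nat := count (fun p => 0 < p)%N la.

(* Boxes of the Young diagram, in (row, column) coordinates starting at 0. *)
Notation box la := {i : 'I_(size la) & 'I_(nth 0%N la i)}.

Definition box_row (la : seq nat) (b : box la) : nat := tag b.
Definition box_col (la : seq nat) (b : box la) : nat := tagged b.

Definition semistandard (N : nat) (la : seq nat)
    (S : {ffun box la -> 'I_N}) : bool :=
  [forall a : box la, forall b : box la,
     ((box_row a == box_row b) && (box_col a < box_col b)%N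
        ==> (S a <= S b)%N)
  && ((box_col a == box_col b) && (box_row a < box_row b)%N
        ==> (S a < S b)%N)].

(* s_la(x_1, ..., x_N) as the generating function of semistandard tableaux
   with entries in [N]; there are none when la has more than N parts. *)
Definition schur (F : comPzRingType) (N : nat) (la : seq nat)
    (x : 'I_N -> F) : F :=
  \sum_(S : {ffun box la -> 'I_N} | semistandard S) \prod_(b : box la) x (S b).

Section Gaudin.
Variable C : numClosedFieldType.

(* The eigenvalues with algebraic multiplicity, in an unspecified order. *)
Definition eigenvalues (N : nat) (X : 'M[C]_N) : seq C :=
  sval (closed_field_poly_normal (char_poly X)).

Definition schur_mx (N : nat) (la : seq nat) (X : 'M[C]_N) : C :=
  schur la (fun i : 'I_N => (eigenvalues X)`_i).

Definition partial (I : eqType) (k : I) (g : (I -> C) -> C) : (I -> C) -> C :=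
  fun e => derive1 (fun t : C => g (fun l => if l == k then t else e l)) (e k).

(* The mixed partial derivative, of order one in every variable, at 0. *)
Definition mixed_partial0 (I : finType) (g : (I -> C) -> C) : C :=
  foldr (@partial I) g (enum I) (fun=> 0).

(* Coordinates on the n-th tensor power of C^N are taken in the orthonormal
   basis e_(a 0) (x) ... (x) e_(a (n-1)), indexed by a : {ffun 'I_n -> 'I_N};
   operators act on column vectors. *)
Definition tdim (N n : nat) : nat := #|{ffun 'I_n -> 'I_N}|.

Definition site (N n : nat) (k : 'I_n) (A : 'M[C]_N) : 'M[C]_(tdim N n) :=
  \matrix_(p, q)
    let a : {ffun 'I_n -> 'I_N} := enum_val p in
    let b : {ffun 'I_n -> 'I_N} := enum_val q in
    A (a k) (b k) * (\prod_(l < n | l != k) (a l == b l)%:R).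

(* The operator d_K f(h).  The matrix units at distinct sites commute, so the
   order of the product is immaterial. *)
Definition dK (N n : nat) (K : {set 'I_n}) (f : 'M[C]_N -> C) (h : 'M[C]_N) :
    'M[C]_(tdim N n) :=
  \sum_(ij : {ffun {k : 'I_n | k \in K} -> 'I_N * 'I_N})
    mixed_partial0 (fun e : {k : 'I_n | k \in K} -> C =>
      f (h + \sum_k e k *: delta_mx (ij k).2 (ij k).1))
    *: \prod_k site (val k) (delta_mx (ij k).1 (ij k).2).

(* A polynomial in u with matrix coefficients is encoded as a matrix of
   polynomials in u. *)
Definition gaudin (N n : nat) (la : seq nat) (h : 'M[C]_N) (z : 'I_n -> C) :
    'M[{poly C}]_(tdim N n) :=
  \sum_(K : {set 'I_n})
    (\prod_(k in ~: K) ('X + (z k)%:P))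
    *: map_mx polyC (dK K (schur_mx la) h).

Definition gaudin_at (N n : nat) (la : seq nat) (h : 'M[C]_N) (z : 'I_n -> C)
    (t : C) : 'M[C]_(tdim N n) :=
  map_mx (horner_eval t) (gaudin la h z).

Definition possemidef (d : nat) (A : 'M[C]_d) : Prop :=
  A \is hermsymmx /\ forall v : 'cV[C]_d, 0 <= (v ^t* *m A *m v) 0 0.

Definition posdef (d : nat) (A : 'M[C]_d) : Prop :=
  A \is hermsymmx /\
  forall v : 'cV[C]_d, v != 0 -> 0 < (v ^t* *m A *m v) 0 0.

End Gaudin.

(* Main.v *)
Require Import Defs.
From mathcomp Require Import all_boot all_order all_algebra all_fingroup.
From mathcomp Require Import complex.
From mathcomp Require Import all_classical all_reals all_analysis.
From mathcomp Require Import fintype finset zify ring.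

(** The reason T_la(t) is positive is that s_la is a character.  Let B be the
    set of boxes of la, and let W, inside the tensor power of C^N indexed by B,
    be the Weyl module of la.  Every X^(tensor B) preserves W, and its trace on W
    is s_la(X).  Hence, if the rows of V form an orthonormal basis of W,
      s_la(X) = tr (V X^(tensor B) V^* )
    for every matrix X, which displays s_la(X) as a sum of diagonal matrix
    coefficients v X^(tensor B) v^*  ([schur_mx_gram]).

    Differentiating at h in the directions E_(j,i) and multiplying by E_(i,j)
    produces, once summed over i and j, the flip of a site with a box.  So
    d_K s_la(h) is a sum over the ways psi of gluing the sites of K to distinct
    boxes, and each term is the partial trace, over the boxes left free, of the
    orthogonal projection onto W against h.  As h is diagonal and nonnegative,
    this is a combination of rank one Gram matrices u^* u whose coefficients are
    monomials in the h_i ([dK_gram]).  Thus every d_K s_la(h) is positive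
    semidefinite, and so is T_la(t), whose coefficients prod (t + z_k) are
    nonnegative.  In the strict case the term of K = set0 is s_la(h) prod (t + z_k)
    times the identity, and s_la(h) > 0 because the tableau whose r-th row is
    filled with the r-th index of a positive h_i has positive weight
    ([schur_gt0]).

    It remains to see that s_la is the character of W.  The module W is spanned
    by the vectors w_S, for S an arbitrary filling of B, obtained from the basis
    vector e_S by antisymmetrizing along columns and symmetrizing along rows.
    Those with S semistandard are linearly independent by triangularity
    ([weyl_mx_free]), and they span by the Garnir straightening relations
    ([weyl_vec_span]).  A diagonal matrix multiplies w_S by the monomial of S, so
    the character of W takes the value s_la on diagonal matrices
    ([weyl_char_diag]).  It is invariant under conjugation, every complex matrix
    is conjugate to a triangular one, and a triangular matrix degenerates to its
    diagonal through its conjugates by diag(t^i), t -> 0; since the character is a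
    polynomial, it therefore depends on the eigenvalues only
    ([weyl_char_eigenvalues]). *)

Set Implicit Arguments.
Unset Strict Implicit.
Unset Printing Implicit Defensive.

Import Order.TTheory GRing.Theory Num.Theory.

Local Open Scope ring_scope.
Local Open Scope sesquilinear_scope.

(** * Sums, polynomials, and tensor products of matrices *)

Lemma sum_enum_val (I : finType) (V : nmodType) (F : I -> V) :
  \sum_i F i = \sum_(k < #|I|) F (enum_val k).
Proof. by rewrite (reindex _ (onW_bij _ (@enum_val_bij I))). Qed.

Lemma sum_option (I : finType) (V : nmodType) (F : option I -> V) :
  \sum_o F o = F None + \sum_k F (Some k).
Proof.
rewrite (bigD1 None) //=; congr (_ + _).
rewrite (reindex_omap Some id) => [|[k|] //]; apply: eq_bigl => k.
by rewrite /= eqxx.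
Qed.

Lemma sum_eq_indicators (R : comNzRingType) (J : finType) (F : J -> R) (x y : J) :
  \sum_j F j * ((x == j)%:R * (y == j)%:R) = (x == y)%:R * F x.
Proof.
rewrite (bigD1 x) //= eqxx mul1r big1 ?addr0 => [|j ne_jx].
  by rewrite mulrC eq_sym.
by rewrite eq_sym (negPf ne_jx) mul0r mulr0.
Qed.

(** Algebraic substitute for a limit t -> 0: a polynomial that takes the value c
    at infinitely many points is c. *)
Lemma poly_const_punctured (C : numDomainType) (p : {poly C}) c :
  (forall t, t != 0 -> p.[t] = c) -> p.[0] = c.
Proof.
move=> pc; apply/eqP; rewrite -subr_eq0 -(hornerC c 0) -hornerN -hornerD.
suff -> : p - c%:P = 0 by rewrite horner0.
apply/eqP/negPn/negP => nz.
(* p - c vanishes at 1, 2, ..., size (p - c), which is one root too many. *)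
pose rs : seq C := [seq k.+1%:R | k <- iota 0 (size (p - c%:P))].
have : (size rs < size (p - c%:P)%R)%N.
  apply: max_poly_roots => //.
    apply/allP => _ /mapP[k _ ->]; apply/rootP.
    by rewrite hornerD hornerN hornerC pc ?subrr ?pnatr_eq0.
  rewrite map_inj_uniq ?iota_uniq // => j k /eqP.
  by rewrite eqr_nat eqSS => /eqP.
by rewrite size_map size_iota ltnn.
Qed.

(** Conjugate matrices have conjugate characteristic matrices. *)
Lemma char_poly_similar (R : comNzRingType) n (P Q X : 'M[R]_n) : Q *m P = 1%:M ->
  char_poly (P *m X *m Q) = char_poly X.
Proof.
move=> QP; have PQ := mulmx1C QP; rewrite /char_poly.
have -> : char_poly_mx (P *m X *m Q)
    = map_mx polyC P *m char_poly_mx X *m map_mx polyC Q.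
  rewrite /char_poly_mx mulmxBr mulmxBl !map_mxM; congr (_ - _).
  by rewrite -mulmxA -scalar_mxC mulmxA -map_mxM PQ map_mx1 mul1mx.
rewrite !det_mulmx mulrAC -det_mulmx -map_mxM PQ map_mx1 det1.
by rewrite mul1r.
Qed.

Section TensorProduct.
Variables (R : comNzRingType) (B : finType) (N : nat).
Local Notation filling := {ffun B -> 'I_N}.

(** The tensor product of the [X b], acting on words B -> 'I_N. *)
Definition tensmx (X : B -> 'M[R]_N) : 'M[R]_#|{: filling}| :=
  \matrix_(p, q) \prod_b X b ((enum_val p : filling) b) ((enum_val q : filling) b).

Lemma tensmxM X Y : tensmx X *m tensmx Y = tensmx (fun b => X b *m Y b).
Proof.
apply/matrixP => p q; rewrite !mxE.
rewrite (eq_bigr (fun b => \sum_k X b ((enum_val p : filling) b) k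
                                  * Y b k ((enum_val q : filling) b))); last first.
  by move=> b _; rewrite mxE.
rewrite bigA_distr_bigA [RHS]sum_enum_val; apply: eq_bigr => k _.
by rewrite big_split !mxE.
Qed.

Lemma tensmx1 : tensmx (fun=> 1%:M) = 1%:M.
Proof.
apply/matrixP => p q; rewrite !mxE; have [->|ne_pq] := eqVneq p q.
  by rewrite big1 // => b _; rewrite mxE eqxx.
have [b ne_b] : exists b, (enum_val p : filling) b != (enum_val q : filling) b.
  apply/existsP; rewrite -negb_forall; apply: contra ne_pq => /forallP eq_pq.
  by apply/eqP/enum_val_inj/ffunP => b; apply/eqP.
by rewrite (bigD1 b) //= mxE (negPf ne_b) mul0r.
Qed.

End TensorProduct.

(** * Permutations that preserve monotonicity *)

(** A counting argument for the uniqueness of sorted rearrangements.  If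
    [val (s x) < val x], the cells with [val (s y) < val x] include all the cells
    up to x, whereas those with [val y < val x] all lie strictly before x; but s
    puts the two sets in bijection. *)
Lemma monotone_perm_le (B : finType) (D : {set B}) (pos val : B -> nat)
    (s : {perm B}) :
  {in D &, injective pos} -> (forall b, (s b \in D) = (b \in D)) ->
  {in D &, forall a b, (pos a < pos b)%N -> (val a <= val b)%N} ->
  {in D &, forall a b, (pos a < pos b)%N -> (val (s a) <= val (s b))%N} ->
  {in D, forall b, (val b <= val (s b))%N}.
Proof.
move=> pos_inj sD val_mono vals_mono x xD; rewrite leqNgt; apply/negP => lt_sx.
pose E1 := [set y in D | (val y < val x)%N].
pose E2 := [set y in D | (val (s y) < val x)%N].
pose P1 := [set y in D | (pos y < pos x)%N].
pose P2 := [set y in D | (pos y <= pos x)%N].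
have le21 : (#|E2| <= #|E1|)%N.
  rewrite -(card_imset _ (@perm_inj _ s)); apply: subset_leq_card.
  by apply/subsetP => _ /imsetP[y + ->]; rewrite !inE sD.
have sub1 : E1 \subset P1.
  apply/subsetP => y; rewrite !inE => /andP[yD lt_yx]; rewrite yD ltnNge leq_eqVlt.
  apply/negP => /orP[/eqP eq_xy|lt_xy].
    by rewrite (pos_inj _ _ xD yD eq_xy) ltnn in lt_yx.
  by rewrite ltnNge (val_mono x y) in lt_yx.
have sub2 : P2 \subset E2.
  apply/subsetP => y; rewrite !inE leq_eqVlt => /andP[yD /orP[/eqP eq_xy|lt_yx]].
    by rewrite (pos_inj _ _ yD xD eq_xy) xD.
  by rewrite yD (leq_ltn_trans _ lt_sx) ?vals_mono.
have : P1 \proper P2.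
  apply/properP; split.
    by apply/subsetP => y; rewrite !inE => /andP[-> /ltnW->].
  by exists x; rewrite !inE xD ?ltnn ?leqnn.
move=> /proper_card; rewrite ltnNge => /negP; apply.
exact: leq_trans (subset_leq_card sub2) (leq_trans le21 (subset_leq_card sub1)).
Qed.

(** Used twice below: along columns to see that a column-strict filling has only
    one sorted column rearrangement, and along rows to see that a row-weakly
    increasing filling is determined by the contents of its rows. *)
Lemma monotone_perm_eq (B : finType) (D : {set B}) (pos val : B -> nat)
    (s : {perm B}) :
  {in D &, injective pos} -> (forall b, (s b \in D) = (b \in D)) ->
  {in D &, forall a b, (pos a < pos b)%N -> (val a <= val b)%N} ->
  {in D &, forall a b, (pos a < pos b)%N -> (val (s a) <= val (s b))%N} ->
  {in D, forall b, val (s b) = val b}.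
Proof.
move=> pos_inj sD val_mono vals_mono b bD; apply/eqP; rewrite eqn_leq.
rewrite (@monotone_perm_le _ D pos val s) // andbT.
have sVD c : ((s^-1)%g c \in D) = (c \in D) by rewrite -sD permKV.
rewrite -{2}(permKV s b).
apply: (@monotone_perm_le _ D pos (fun c => val (s c)) s^-1%g) => //.
by move=> a c aD cD lt_ac; rewrite !permKV val_mono.
Qed.

(** * The Weyl module of a diagram and the Garnir relations *)

Section WeylModule.
Variables (B : finType) (row col : B -> nat).
Hypothesis cell_inj : forall a b, row a = row b -> col a = col b -> a = b.
Hypothesis young : forall b i j, (i <= row b)%N -> (j <= col b)%N ->
  exists2 a, row a = i & col a = j.
Variables (C : numClosedFieldType) (N : nat).
Local Notation filling := {ffun B -> 'I_N}.
Implicit Types (S T : filling) (r s t : {perm B}).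

(** Place permutation of the basis tensor e_S. *)
Definition pull S s : filling := [ffun b => S (s b)].

Lemma pullM S s t : pull (pull S s) t = pull S (t * s)%g.
Proof. by apply/ffunP => b; rewrite !ffunE permM. Qed.

Lemma pull1 S : pull S 1%g = S.
Proof. by apply/ffunP => b; rewrite !ffunE perm1. Qed.

Definition row_stab : {set {perm B}} := [set s : {perm B} | [forall b, row (s b) == row b]].
Definition col_stab : {set {perm B}} := [set s : {perm B} | [forall b, col (s b) == col b]].

Lemma row_stabP s : reflect (forall b, row (s b) = row b) (s \in row_stab).
Proof. by rewrite inE; apply: (iffP forallP) => H b; apply/eqP; rewrite ?H. Qed.

Lemma col_stabP s : reflect (forall b, col (s b) = col b) (s \in col_stab).
Proof. by rewrite inE; apply: (iffP forallP) => H b; apply/eqP; rewrite ?H. Qed.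

Lemma tperm_row_stab a b : row a = row b -> tperm a b \in row_stab.
Proof. by move=> eq_ab; apply/row_stabP => c; case: tpermP => // ->. Qed.

Lemma tperm_col_stab a b : col a = col b -> tperm a b \in col_stab.
Proof. by move=> eq_ab; apply/col_stabP => c; case: tpermP => // ->. Qed.

Lemma row_stabMr r s : r \in row_stab -> (s * r \in row_stab)%g = (s \in row_stab).
Proof.
move=> /row_stabP rH; apply/row_stabP/row_stabP => H b.
  by have := H b; rewrite permM rH.
by rewrite permM rH H.
Qed.

Lemma col_stabMr r s : r \in col_stab -> (s * r \in col_stab)%g = (s \in col_stab).
Proof.
move=> /col_stabP rH; apply/col_stabP/col_stabP => H b.
  by have := H b; rewrite permM rH.
by rewrite permM rH H.
Qed.

(** Coordinate on e_T of w_S, the vector obtained from e_S by antisymmetrizing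
    along the columns and then symmetrizing along the rows.  The w_S span the
    image of a Young symmetrizer, which is the Weyl module. *)
Definition weyl_coef S T : C :=
  \sum_(r in row_stab) \sum_(s in col_stab)
    (-1) ^+ odd_perm s * (T == pull (pull S s) r)%:R.

Lemma weyl_coef_col S T t : t \in col_stab ->
  weyl_coef (pull S t) T = (-1) ^+ odd_perm t * weyl_coef S T.
Proof.
move=> tC; rewrite /weyl_coef mulr_sumr; apply: eq_bigr => r _.
rewrite mulr_sumr [RHS](reindex_inj (mulIg t)); apply: eq_big => [s|s _].
  by rewrite col_stabMr.
by rewrite !pullM odd_permM addbC signr_addb -mulrA signrMK !mulgA.
Qed.

(** When every column permutation s sends two cells c, d of a common row into A,
    the terms of the sum cancel in pairs: left multiplication of t by the
    transposition of s c and s d, which changes the sign, has the same effect on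
    the filling as multiplying the row permutation by the transposition of c and
    d. *)
Lemma garnir (A : {set B}) S T :
  (forall s, s \in col_stab ->
    exists c d, [/\ c != d, row c = row d, s c \in A & s d \in A]) ->
  \sum_(t | perm_on A t) (-1) ^+ odd_perm t * weyl_coef (pull S t) T = 0.
Proof.
move=> pigeon.
rewrite (eq_bigr (fun t => \sum_(s in col_stab) \sum_(r in row_stab)
   (-1) ^+ odd_perm t * ((-1) ^+ odd_perm s *
      (T == pull S (r * (s * t))%g)%:R : C))); last first.
  move=> t _; rewrite /weyl_coef exchange_big mulr_sumr; apply: eq_bigr => s _.
  by rewrite mulr_sumr; apply: eq_bigr => r _; rewrite !pullM !mulgA.
rewrite exchange_big big1 // => s sC.
have [c [d [neq_cd row_cd scA sdA]]] := pigeon s sC.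
(* The involution pairs (t, r) with (y * t, r * x). *)
pose x := tperm c d; pose y := tperm (s c) (s d).
have yxE : (s * y = x * s)%g by rewrite /y -tpermJ conjgE mulgA mulgV mul1g.
set X := BIG_F; apply/eqP; rewrite -eqNr; apply/eqP; rewrite /X {X} -sumrN.
have yA : perm_on A y.
  apply/subsetP => b; rewrite inE; case: tpermP => [-> _|-> _|_ _] //.
  by rewrite eqxx.
rewrite [RHS](reindex_inj (mulgI y)) /=; apply: eq_big => [t|t _].
  by apply/idP/idP => [|tA]; [exact: perm_onM | rewrite -(mulKg y t) tpermV perm_onM].
rewrite -sumrN [RHS](reindex_inj (mulIg x)) /=; apply: eq_big => [r|r _].
  by rewrite row_stabMr // tperm_row_stab.
rewrite odd_permM odd_tperm (inj_eq perm_inj) neq_cd signr_addb mulN1r mulNr.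
congr (- (_ * (_ * (_ == pull S _)%:R))).
by rewrite !mulgA -(mulgA _ s y) yxE !mulgA /x -(mulgA r (tperm c d)) tperm2 mulg1.
Qed.

Definition ssyt S := [forall a, forall b,
     ((row a == row b) && (col a < col b)%N ==> (S a <= S b)%N)
  && ((col a == col b) && (row a < row b)%N ==> (S a < S b)%N)].

Lemma ssytP S : reflect
  ((forall a b, row a = row b -> (col a < col b)%N -> (S a <= S b)%N) /\
   (forall a b, col a = col b -> (row a < row b)%N -> (S a < S b)%N)) (ssyt S).
Proof.
apply: (iffP forallP) => [H|[H1 H2] a].
  split=> a b /eqP eq_ab lt_ab; have /forallP/(_ b)/andP[/implyP P1 /implyP P2] := H a.
    by apply: P1; rewrite eq_ab.
  by apply: P2; rewrite eq_ab.
apply/forallP => b; apply/andP; split; apply/implyP => /andP[/eqP eq_ab lt_ab].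
  exact: H1.
exact: H2.
Qed.

(** A consists of the part of the column of a from a downwards and of the part
    of the column of b from b upwards, where b is to the right of a in the same
    row.  It has one cell more than the column of a, and by the shape of the
    diagram every cell of its inverse image by s lies in a row which meets the
    column of a; hence two of these cells share a row. *)
Lemma garnir_pigeonhole a b s : row a = row b -> (col a < col b)%N ->
  s \in col_stab ->
  let A := [set x | (col x == col a) && (row a <= row x)%N
                 || (col x == col b) && (row x <= row a)%N] in
  exists c d, [/\ c != d, row c = row d, s c \in A & s d \in A].
Proof.
move=> row_ab lt_ab /col_stabP sC A.
pose P c d := [&& c != d, row c == row d, s c \in A & s d \in A].
have [/existsP[c /existsP[d /and4P[ne_cd /eqP? ? ?]]]|noP] :=
  boolP [exists c, exists d, P c d]; first by exists c, d.
have row_inj : {in [set x | s x \in A] &, injective row}.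
  move=> c d; rewrite !inE => cA dA eq_cd; apply/eqP/negPn/negP => ne_cd.
  case/existsP: noP; exists c; apply/existsP; exists d.
  by rewrite /P ne_cd eq_cd eqxx !inE cA dA.
pose mv j x := odflt x [pick y | (row y == row x) && (col y == j)].
have mvP j x : (exists y, row y = row x /\ col y = j) ->
    row (mv j x) = row x /\ col (mv j x) = j.
  move=> [y [row_y col_y]]; rewrite /mv; case: pickP => [u /andP[/eqP ? /eqP ?] //|].
  by move/(_ y); rewrite row_y col_y !eqxx.
pose D := [set x | col x == col a].
have mvA x : s x \in A -> row (mv (col a) x) = row x /\ col (mv (col a) x) = col a.
  rewrite inE !sC => xA; apply: mvP; case/orP: xA => /andP[/eqP eq_x _].
    by exists x.
  have [|y] := @young x (row x) (col a) (leqnn _); last by exists y.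
  by rewrite eq_x ltnW.
have imA x : (x \in [set x | s x \in A]) = (s x \in A) by rewrite in_set.
(* If the inverse image of A met each row once, projecting it onto the column
   of a would make A no larger than that column. *)
have leAD : (#|A| <= #|D|)%N.
  have -> : #|A| = #|[set x | s x \in A]|.
    rewrite -(card_imset [set x | s x \in A] (@perm_inj _ s)).
    apply: eq_card => y; apply/idP/imsetP => [yA|[x xA ->]].
      by exists (s^-1 y)%g; rewrite ?permKV // in_set permKV.
    by move: xA; rewrite in_set.
  rewrite -(card_in_imset (f := mv (col a))).
    apply/subset_leq_card/subsetP => _ /imsetP[x + ->].
    by rewrite imA => /mvA[_ col_x]; rewrite in_set col_x.
  move=> x y xA yA eq_xy; apply: row_inj => //; rewrite imA in xA; rewrite imA in yA.
  by rewrite -(mvA x xA).1 -(mvA y yA).1 eq_xy.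
pose D1 := [set x | (col x == col a) && (row a <= row x)%N].
pose D2 := [set x | (col x == col a) && (row x <= row a)%N].
pose A2 := [set x | (col x == col b) && (row x <= row a)%N].
have mvD x : x \in D2 -> row (mv (col b) x) = row x /\ col (mv (col b) x) = col b.
  rewrite inE => /andP[_ le_xa]; apply: mvP.
  by have [|y] := @young b (row x) (col b) _ (leqnn _); [rewrite -row_ab|exists y].
have leDA : (#|D2| <= #|A2|)%N.
  rewrite -(card_in_imset (f := mv (col b))).
    apply/subset_leq_card/subsetP => _ /imsetP[x xD ->].
    have [row_x col_x] := mvD x xD.
    by move: xD; rewrite !inE row_x col_x eqxx => /andP[].
  move=> x y xD yD eq_xy; apply: cell_inj.
    by rewrite -(mvD x xD).1 -(mvD y yD).1 eq_xy.
  by move: xD yD; rewrite !inE => /andP[/eqP-> _] /andP[/eqP-> _].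
have cardA : (#|A| = #|D1| + #|A2|)%N.
  rewrite -cardsUI [X in (_ + X)%N](_ : _ = 0)%N ?addn0.
    by apply: eq_card => x; rewrite !inE.
  apply: eq_card0 => x; rewrite !inE; apply/negP => /andP[/andP[/eqP + _] /andP[/eqP + _]].
  by move=> -> eq_ab; rewrite eq_ab ltnn in lt_ab.
have cardD : (#|D1| + #|D2| = #|D| + 1)%N.
  rewrite -cardsUI -(cards1 a); congr (_ + _)%N; apply: eq_card => x; rewrite !inE.
    by rewrite -andb_orr leq_total andbT.
  apply/idP/eqP => [/andP[/andP[/eqP eq_x le1] /andP[_ le2]]|->].
    by apply: cell_inj => //; apply/eqP; rewrite eqn_leq le1 le2.
  by rewrite !eqxx !leqnn.
by move: leAD leDA cardA cardD; lia.
Qed.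

(** Straightening makes progress: A1 carries the large values and A2, further to
    the right, the small ones, so a permutation which mixes them moves large
    values to the right and increases the sum of column times value. *)
Lemma garnir_measure S (A1 A2 : {set B}) (j1 j2 v : nat) t :
  [disjoint A1 & A2] -> (j1 < j2)%N ->
  {in A1, forall x, col x = j1} -> {in A2, forall x, col x = j2} ->
  {in A1, forall x, v <= S x}%N -> {in A2, forall x, S x < v}%N ->
  perm_on (A1 :|: A2) t -> t \notin col_stab ->
  (\sum_b col b * S b < \sum_b col b * pull S t b)%N.
Proof.
move=> disA lt_j col1 col2 large1 small2 tA tC.
(* Centring the values at v makes them nonnegative on A1 and negative on A2; this
   is done in C because subtraction of naturals truncates. *)
pose g x : C := (S x)%:R - v%:R.
have lt2 : \sum_(x in A2) g x < \sum_(x in A2) g (t x).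
  rewrite -(big_imset g (h := t)) /=; last by move=> ? ? _ _; exact: perm_inj.
  rewrite (big_setID (t @: A2)) [ltRHS](big_setID A2) /= setIC.
  apply: ler_ltD => //; apply: (@lt_le_trans _ _ 0); last first.
    apply: sumr_ge0 => _ /setDP[/imsetP[x xA ->] txA].
    rewrite subr_ge0 ler_nat large1 //.
    have : t x \in A1 :|: A2 by rewrite perm_closed // inE xA orbT.
    by rewrite inE (negPf txA) orbF.
  have [x xA] : exists x, x \in A2 :\: t @: A2.
    apply/set0Pn; rewrite setD_eq0; apply: contra tC => sub2.
    have eq2 : A2 = t @: A2.
      by apply/eqP; rewrite eqEcard sub2 card_imset ?leqnn //; exact: perm_inj.
    have tA2 x : (t x \in A2) = (x \in A2).
      by rewrite {1}eq2 mem_imset //; exact: perm_inj.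
    apply/col_stabP => x.
    have [xA2|xA2] := boolP (x \in A2); first by rewrite !col2 ?tA2.
    have [xA1|xA1] := boolP (x \in A1); last first.
      by rewrite (out_perm tA) // inE negb_or xA1.
    rewrite !col1 //; have : t x \in A1 :|: A2 by rewrite perm_closed // inE xA1.
    by rewrite inE tA2 (negPf xA2) orbF.
  rewrite (bigD1 x) //= -[ltRHS]addr0; apply: ltr_leD.
    by rewrite subr_lt0 ltr_nat small2 //; case/setDP: xA.
  apply: sumr_le0 => y /andP[/setDP[yA _] _].
  by rewrite subr_le0 ler_nat ltnW ?small2.
have sumA : \sum_(x in A1 :|: A2) g (t x) = \sum_(x in A1 :|: A2) g x.
  rewrite [RHS](reindex_inj (@perm_inj _ t)) /=; apply: eq_bigl => x.
  by rewrite perm_closed.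
suff lt0 : 0 < \sum_b (col b)%:R * (g (t b) - g b).
  rewrite -(ltr_nat C) !natr_sum -subr_gt0 -sumrB (lt_le_trans lt0) //.
  rewrite le_eqVlt; apply/orP; left; apply/eqP; apply: eq_bigr => b _.
  by rewrite !natrM -mulrBr !ffunE /g opprB addrA subrK.
rewrite (bigID (mem (A1 :|: A2))) /=.
have -> : \sum_(x | x \notin A1 :|: A2) (col x)%:R * (g (t x) - g x) = 0.
  by apply: big1 => x xA; rewrite (out_perm tA) // subrr mulr0.
rewrite addr0.
rewrite (eq_bigr (fun x => j1%:R * (g (t x) - g x)
   + (j2%:R - j1%:R) * (if x \in A2 then g (t x) - g x else 0))); last first.
  move=> x; rewrite inE => /orP[xA|xA].
    by rewrite (disjointFr disA xA) mulr0 addr0 col1.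
  by rewrite xA col2 //; ring.
rewrite big_split /= -!mulr_sumr sumrB sumA subrr mulr0 add0r.
rewrite -big_mkcondr /= mulr_gt0 ?subr_gt0 ?ltr_nat //.
rewrite (eq_bigl (mem A2)); last first.
  by move=> x; rewrite /= inE andb_orl andbb orbC; case: (x \in A2); rewrite ?andbF.
by rewrite sumrB subr_gt0.
Qed.

(** * Straightening *)

Definition weyl_vec S : 'rV[C]_#|{: filling}| :=
  \row_j weyl_coef S (enum_val j).

Definition weyl_mx : 'M[C]_(#|ssyt|, #|{: filling}|) :=
  \matrix_(i < #|ssyt|) weyl_vec (enum_val i).

(** Encodes as one number the lexicographic order in which the sum of column
    times value comes first and the sum of row times value second: the latter
    never exceeds the sum of [row b * N]. *)
Definition content_measure S : nat :=
  (\sum_b col b * S b) * (\sum_b row b * N).+1 + \sum_b row b * S b.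

Lemma content_measure_bound S :
  (content_measure S <= (\sum_b col b * N) * (\sum_b row b * N).+1 + \sum_b row b * N)%N.
Proof.
by rewrite leq_add ?leq_mul2r ?leq_sum ?orbT // => b _;
  rewrite leq_mul2l ltnW ?orbT.
Qed.

Lemma weighted_sum_tperm (w : B -> nat) S a b :
  (w a < w b)%N -> (S b < S a)%N ->
  (\sum_x w x * S x < \sum_x w x * pull S (tperm a b) x)%N.
Proof.
move=> lt_w lt_S; have ne_ba : b != a by apply: contraTneq lt_w => ->; rewrite ltnn.
rewrite (bigD1 a) //= (bigD1 b) //= [ltnRHS](bigD1 a) //= [X in (_ < _ + X)%N](bigD1 b) //=.
rewrite !ffunE tpermL tpermR.
rewrite [X in (_ < _ + (_ + X))%N](eq_bigr (fun x => w x * S x)%N); last first.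
  by move=> x /andP[ne_xa ne_xb]; rewrite ffunE tpermD // eq_sym.
rewrite !addnA ltn_add2r; nia.
Qed.

Lemma sum_col_stab S s : s \in col_stab ->
  (\sum_b col b * pull S s b = \sum_b col b * S b)%N.
Proof.
move=> /col_stabP sC; rewrite [RHS](reindex_inj (@perm_inj _ s)) /=.
by apply: eq_bigr => b _; rewrite ffunE sC.
Qed.

Lemma weyl_vec_ssyt S : ssyt S -> (weyl_vec S <= weyl_mx)%MS.
Proof.
move=> sS; rewrite -[S](@enum_rankK_in _ S ssyt) //.
by rewrite (eq_row_sub (enum_rank_in sS S)) // rowK.
Qed.

(** Straightening, by induction along [content_measure].  A column which is not
    strictly increasing is repaired by a transposition, which negates w_S.  If the
    columns are strict and two cells of a row are in the wrong order, the Garnir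
    relation for these cells expresses w_S through fillings of larger measure: the
    permutations of A which preserve the columns all contribute the same multiple
    of w_S, and their number is invertible in characteristic zero. *)
Lemma weyl_vec_span S : (weyl_vec S <= weyl_mx)%MS.
Proof.
have [k] := ubnP ((\sum_b col b * N) * (\sum_b row b * N).+1 + \sum_b row b * N
                  - content_measure S)%N.
elim: k S => // k IH S; rewrite ltnS => le_k.
have {IH le_k} IH T : (content_measure S < content_measure T)%N ->
    (weyl_vec T <= weyl_mx)%MS.
  move=> lt_ST; apply: IH; apply: leq_trans le_k.
  by have := content_measure_bound T; lia.
have [sS|/ssytP notS] := boolP (ssyt S); first exact: weyl_vec_ssyt.
have [/existsP[a /existsP[b /and3P[/eqP col_ab lt_ab le_ba]]]|colS] :=
    boolP [exists a, exists b, [&& col a == col b, row a < row b & S b <= S a]]%N.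
  have tC : tperm a b \in col_stab by exact: tperm_col_stab.
  have ne_ab : a != b by apply: contraTneq lt_ab => ->; rewrite ltnn.
  have sgn_t : weyl_vec (pull S (tperm a b)) = - weyl_vec S.
    apply/rowP => j; rewrite !mxE weyl_coef_col // odd_tperm ne_ab.
    by rewrite expr1 mulN1r.
  rewrite -[weyl_vec S]opprK -sgn_t eqmx_opp.
  move: le_ba; rewrite leq_eqVlt => /orP[/eqP eq_S|lt_S].
    suff eq_pull : pull S (tperm a b) = S.
      rewrite eq_pull in sgn_t *; have /eqP := sgn_t.
      rewrite -addr_eq0 -mulr2n -scaler_nat scaler_eq0 pnatr_eq0 => /eqP -> /=.
      exact: sub0mx.
    by apply/ffunP => x; rewrite ffunE; case: tpermP => // ->; apply/val_inj.
  apply: IH; rewrite /content_measure sum_col_stab // ltn_add2l.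
  exact: weighted_sum_tperm.
have {}colS a b : col a = col b -> (row a < row b)%N -> (S a < S b)%N.
  move=> col_ab lt_ab; rewrite ltnNge; apply: contra colS => le_ba.
  by apply/existsP; exists a; apply/existsP; exists b; rewrite col_ab eqxx lt_ab.
have [/existsP[a /existsP[b /and3P[/eqP row_ab lt_ab lt_ba]]]|rowS] :=
    boolP [exists a, exists b, [&& row a == row b, col a < col b & S b < S a]]%N;
  last first.
  case: notS; split=> // a b row_ab lt_ab; rewrite leqNgt; apply: contra rowS => lt_ba.
  by apply/existsP; exists a; apply/existsP; exists b; rewrite row_ab eqxx lt_ab.
have colS' x y : col x = col y -> (row x <= row y)%N -> (S x <= S y)%N.
  move=> col_xy; rewrite leq_eqVlt => /orP[/eqP row_xy|/colS/ltnW-> //].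
  by rewrite (cell_inj row_xy col_xy).
pose A1 := [set x | (col x == col a) && (row a <= row x)%N].
pose A2 := [set x | (col x == col b) && (row x <= row a)%N].
pose A := [set x | (col x == col a) && (row a <= row x)%N
                || (col x == col b) && (row x <= row a)%N].
have AE : A = A1 :|: A2 by apply/setP => x; rewrite !inE.
pose G t := (-1) ^+ odd_perm t *: weyl_vec (pull S t).
have sum0 : \sum_(t | perm_on A t) G t = 0.
  apply/rowP => j; rewrite summxE mxE.
  rewrite -[RHS](@garnir A S (enum_val j)).
    by apply: eq_bigr => t _; rewrite !mxE.
  by move=> s; exact: garnir_pigeonhole.
rewrite (bigID (mem col_stab)) /= in sum0.
rewrite (eq_bigr (fun=> weyl_vec S)) in sum0; last first.
  move=> t /andP[_ tC]; apply/rowP => j; rewrite !mxE weyl_coef_col //.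
  by rewrite signrMK.
rewrite sumr_const in sum0; set n0 := #|_| in sum0.
have n0_gt0 : (0 < n0)%N.
  apply/card_gt0P; exists 1%g; rewrite unfold_in /= perm_on1.
  by apply/col_stabP => b'; rewrite perm1.
have -> : weyl_vec S = - (n0%:R^-1 *: \sum_(t | perm_on A t && (t \notin col_stab)) G t).
  move/eqP: sum0; rewrite addrC addr_eq0 => /eqP ->.
  rewrite scalerN opprK -scaler_nat scalerA mulVf ?scale1r //.
  by rewrite pnatr_eq0 -lt0n.
rewrite eqmx_opp scalemx_sub // summx_sub // => t /andP[tA tC].
apply/scalemx_sub/IH.
suff lt_c : (\sum_b col b * S b < \sum_b col b * pull S t b)%N.
  have : (\sum_b row b * S b <= \sum_b row b * N)%N.
    by apply: leq_sum => x _; rewrite leq_mul2l ltnW ?orbT.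
  by rewrite /content_measure; move: lt_c; nia.
apply: (@garnir_measure S A1 A2 (col a) (col b) (S a)) => //.
- rewrite -setI_eq0; apply/eqP/setP => x; rewrite !inE; apply/negP.
  by move=> /andP[/andP[/eqP-> _] /andP[/eqP eq_ab _]]; rewrite eq_ab ltnn in lt_ab.
- by move=> x; rewrite inE => /andP[/eqP].
- by move=> x; rewrite inE => /andP[/eqP].
- by move=> x; rewrite inE => /andP[/eqP eq_x le_x]; apply: colS'.
- move=> x; rewrite inE => /andP[/eqP eq_x le_x]; apply: leq_ltn_trans lt_ba.
  by apply: colS'; rewrite -?row_ab.
- by rewrite -AE.
Qed.

(** * Linear independence *)

(** A column permutation of S that maximizes the sum of row times value has
    sorted columns, for otherwise a transposition would increase the sum; and S,
    being column-strict, has no other sorted rearrangement than itself. *)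
Lemma col_stab_max S s : ssyt S -> s \in col_stab ->
  (forall u, u \in col_stab ->
     (\sum_b row b * pull S u b <= \sum_b row b * pull S s b)%N) ->
  s = 1%g.
Proof.
move=> /ssytP[_ colS] sC max_s; apply/permP => x; rewrite perm1.
have /col_stabP sC' := sC.
have eqS : S (s x) = S x :> nat.
  apply: (@monotone_perm_eq _ [set y | col y == col x] row (fun y => S y)).
  - by move=> a b; rewrite !inE => /eqP a_x /eqP b_x eq_ab; apply: cell_inj; rewrite ?a_x ?b_x.
  - by move=> b; rewrite !inE sC'.
  - by move=> a b; rewrite !inE => /eqP a_x /eqP b_x /colS/ltnW; apply; rewrite b_x.
  - move=> a b; rewrite !inE => /eqP a_x /eqP b_x lt_ab; rewrite leqNgt; apply/negP => lt_S.
    have := max_s (tperm a b * s)%g; rewrite col_stabMr // tperm_col_stab ?b_x // => /(_ isT).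
    rewrite leqNgt -pullM => /negP; apply; apply: weighted_sum_tperm => //.
    by rewrite !ffunE.
  - by rewrite inE.
have [lt_x|lt_x|eq_row] := ltngtP (row (s x)) (row x).
- by have := colS _ _ (sC' x) lt_x; rewrite eqS ltnn.
- by have := colS _ _ (esym (sC' x)) lt_x; rewrite eqS ltnn.
- exact: cell_inj.
Qed.

Lemma col_stab_decreases S s : ssyt S -> s \in col_stab -> s != 1%g ->
  (\sum_b row b * pull S s b < \sum_b row b * S b)%N.
Proof.
move=> sS sC; apply: contraNT; rewrite -leqNgt => le_s.
have C1 : 1%g \in col_stab by apply/col_stabP => b; rewrite perm1.
have [u uC max_u] := arg_maxnP (fun u => \sum_b row b * pull S u b)%N C1.
have u1 := col_stab_max sS uC max_u.
apply/eqP/(col_stab_max sS sC) => v vC; apply: leq_trans (max_u v vC) _.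
by rewrite u1 pull1.
Qed.

Lemma sum_row_stab S r : r \in row_stab ->
  (\sum_b row b * pull S r b = \sum_b row b * S b)%N.
Proof.
move=> /row_stabP rR; rewrite [RHS](reindex_inj (@perm_inj _ r)) /=.
by apply: eq_bigr => b _; rewrite ffunE rR.
Qed.

(** If e_T occurs in w_S then T is, up to a row permutation, a column
    rearrangement of S.  A nontrivial one lowers the sum of row times value, and a
    trivial one leaves T and S with the same rows, hence equal as both have
    weakly increasing rows. *)
Lemma weyl_coef_triangular S T : ssyt S -> ssyt T -> weyl_coef S T != 0 ->
  T = S \/ (\sum_b row b * T b < \sum_b row b * S b)%N.
Proof.
move=> sS sT ne0.
have [r rR [s sC TE]] : exists2 r, r \in row_stab & exists2 s, s \in col_stab &
    T = pull (pull S s) r.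
  have [/existsP[r /existsP[s /and3P[rR sC /eqP TE]]]|noP] := boolP
    [exists r, exists s, [&& r \in row_stab, s \in col_stab & T == pull (pull S s) r]].
    by exists r => //; exists s.
  case/eqP: ne0; apply: big1 => r rR; apply: big1 => s sC.
  case: eqP => [TE|]; last by rewrite mulr0.
  by case/existsP: noP; exists r; apply/existsP; exists s; rewrite rR sC TE eqxx.
have [s1|s_neq1] := eqVneq s 1%g; last first.
  by right; rewrite TE sum_row_stab // col_stab_decreases.
left; rewrite s1 pull1 in TE; apply/ffunP => x; apply/val_inj.
have /ssytP[rowS _] := sS; have /ssytP[rowT _] := sT; have /row_stabP rR' := rR.
have valT y : T y = S (r y) by rewrite TE ffunE.
rewrite valT.
apply: (@monotone_perm_eq _ [set y | row y == row x] col (fun y => S y)).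
- by move=> a b; rewrite !inE => /eqP a_x /eqP b_x eq_ab; apply: cell_inj; rewrite ?a_x ?b_x.
- by move=> b; rewrite !inE rR'.
- by move=> a b; rewrite !inE => /eqP a_x /eqP b_x; apply: rowS; rewrite b_x.
- by move=> a b; rewrite !inE -!valT => /eqP a_x /eqP b_x; apply: rowT; rewrite b_x.
- by rewrite inE.
Qed.

(** Only the trivial column permutation contributes, so this coefficient counts
    the row permutations that fix S. *)
Lemma weyl_coef_diag S : ssyt S -> weyl_coef S S != 0.
Proof.
move=> sS; rewrite /weyl_coef.
rewrite (eq_bigr (fun r => (S == pull S r)%:R)); last first.
  move=> r rR; rewrite (bigD1 1%g) /=; last by apply/col_stabP => b; rewrite perm1.
  rewrite odd_perm1 mul1r pull1 big1 ?addr0 // => s /andP[sC s1].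
  case: eqP => [SE|]; last by rewrite mulr0.
  have := col_stab_decreases sS sC s1.
  by rewrite -(sum_row_stab (pull S s) rR) -SE ltnn.
rewrite -natr_sum pnatr_eq0 (bigD1 1%g) /=; last by apply/row_stabP => b; rewrite perm1.
by rewrite pull1 eqxx.
Qed.

Lemma weyl_mx_free : row_free weyl_mx.
Proof.
apply: inj_row_free => v v0; apply/rowP => i0; rewrite mxE; apply/eqP/negPn/negP => v_i0.
(* Among the fillings in the support of the relation, one with the largest
   sum of row times value occurs in no other w_S of the support. *)
have [i v_i max_i] := @arg_maxnP _ i0 (fun i => v 0 i != 0)
  (fun i => \sum_b row b * (enum_val i : filling) b)%N v_i0.
have si : ssyt (enum_val i) by exact: (enum_valP i).
have /rowP/(_ (enum_rank (enum_val i : filling))) := v0; rewrite !mxE.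
rewrite (bigD1 i) //= big1 ?addr0 => [|k ne_ki]; rewrite !mxE enum_rankK.
  by apply/eqP; rewrite mulf_neq0 // weyl_coef_diag.
have [->|v_k] := eqVneq (v 0 k) 0; first by rewrite mul0r.
apply/eqP; rewrite mulf_eq0 (negPf v_k) /=; apply/negPn/negP => ne0.
have sk : ssyt (enum_val k) by exact: (enum_valP k).
have [/enum_val_inj/eqP|] := weyl_coef_triangular sk si ne0.
  by rewrite eq_sym (negPf ne_ki).
by rewrite ltnNge => /negP[]; exact: max_i.
Qed.

(** * The character on diagonal matrices *)

Local Notation tenspow X := (tensmx (fun=> X)).

(** Tensor powers of X commute with place permutations, so X acts on the w_S as
    it acts on the e_S. *)
Lemma weyl_vec_tenspow S X :
  weyl_vec S *m tenspow X = \sum_(T : filling) (\prod_b X (S b) (T b)) *: weyl_vec T.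
Proof.
apply/rowP => q; rewrite !mxE summxE; set Q : filling := enum_val q.
transitivity (\sum_(r in row_stab) \sum_(s in col_stab)
   (-1) ^+ odd_perm s * \prod_b X (S b) (pull Q (r * s)^-1%g b)).
  rewrite (eq_bigr (fun k => (weyl_coef S (enum_val k)
       * \prod_b X ((enum_val k : filling) b) (Q b)))); last by move=> k _; rewrite !mxE.
  rewrite -(sum_enum_val (fun T : filling => weyl_coef S T
       * \prod_b X (T b) (Q b))) /=.
  rewrite (eq_bigr (fun T => \sum_(r in row_stab) \sum_(s in col_stab)
     ((-1) ^+ odd_perm s * (T == pull (pull S s) r)%:R * \prod_b X (T b) (Q b)))); last first.
    by move=> T _; rewrite mulr_suml; apply: eq_bigr => r _; rewrite mulr_suml.
  rewrite exchange_big; apply: eq_bigr => r _; rewrite exchange_big; apply: eq_bigr => s _.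
  rewrite (bigD1 (pull (pull S s) r)) //= eqxx mulr1 [X in _ + X]big1 ?addr0; last first.
    by move=> T ne_T; rewrite (negPf ne_T) mulr0 mul0r.
  congr (_ * _); rewrite [RHS](reindex_inj (@perm_inj _ (r * s)%g)) /=.
  by apply: eq_bigr => b _; rewrite pullM !ffunE permK.
rewrite (eq_bigr (fun T => \sum_(r in row_stab) \sum_(s in col_stab)
   ((-1) ^+ odd_perm s * (Q == pull (pull T s) r)%:R * \prod_b X (S b) (T b)))); last first.
  move=> T _; rewrite !mxE mulrC mulr_suml; apply: eq_bigr => r _.
  by rewrite mulr_suml.
rewrite [RHS]exchange_big; apply: eq_bigr => r _; rewrite [RHS]exchange_big.
apply: eq_bigr => s _; rewrite (bigD1 (pull Q (r * s)^-1%g)) //= !pullM.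
rewrite ?mulgA mulgV pull1 eqxx mulr1 [X in _ + X]big1 ?addr0 // => T ne_T.
case: eqP => [QT|]; last by rewrite mulr0 mul0r.
by case/eqP: ne_T; rewrite QT !pullM -?mulgA mulVg pull1.
Qed.

Lemma weyl_mx_stable X : (weyl_mx *m tenspow X <= weyl_mx)%MS.
Proof.
apply/row_subP => i; rewrite row_mul rowK weyl_vec_tenspow summx_sub // => T _.
exact/scalemx_sub/weyl_vec_span.
Qed.

Lemma weyl_vec_diag S d :
  weyl_vec S *m tenspow (diag_mx d) = (\prod_b d 0 (S b)) *: weyl_vec S.
Proof.
rewrite weyl_vec_tenspow (bigD1 S) //= [X in _ + X]big1 ?addr0 => [|T ne_TS].
  by congr (_ *: _); apply: eq_bigr => b _; rewrite mxE eqxx.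
have [b ne_b] : exists b, S b != T b.
  apply/existsP; rewrite -negb_forall; apply: contra ne_TS => /forallP eq_ST.
  by apply/eqP/ffunP => b; apply/esym/eqP.
by rewrite (bigD1 b) //= mxE (negPf ne_b) mul0r scale0r.
Qed.

(** Orthonormality matters: it makes the trace on the Weyl module a sum of
    diagonal matrix coefficients v X v^*, which is where positivity comes from. *)
Definition weyl_onb := schmidt weyl_mx.

Lemma weyl_onb_unitary : weyl_onb \is unitarymx.
Proof.
apply: schmidt_unitarymx; move: weyl_mx_free; rewrite /row_free => /eqP {1}<-.
exact: rank_leq_col.
Qed.

Lemma weyl_onb_eqmx : (weyl_onb :=: weyl_mx)%MS.
Proof. exact: eqmx_schmidt_free weyl_mx_free. Qed.

Lemma weyl_onbK m (A : 'M[C]_(m, #|{: filling}|)) : (A <= weyl_mx)%MS ->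
  A *m weyl_onb^t* *m weyl_onb = A.
Proof.
rewrite -weyl_onb_eqmx => /submxP[D ->].
by rewrite mulmxtVK ?weyl_onb_unitary.
Qed.

Definition weyl_rep (X : 'M[C]_N) := weyl_onb *m tenspow X *m weyl_onb^t*.

Lemma weyl_repM X Y : weyl_rep (X *m Y) = weyl_rep X *m weyl_rep Y.
Proof.
rewrite /weyl_rep -tensmxM !mulmxA weyl_onbK //.
by rewrite (eqmxMr _ weyl_onb_eqmx) weyl_mx_stable.
Qed.

Lemma weyl_rep1 : weyl_rep 1%:M = 1%:M.
Proof. by rewrite /weyl_rep tensmx1 mulmx1; apply/unitarymxP/weyl_onb_unitary. Qed.

Definition weyl_char (X : 'M[C]_N) := \tr (weyl_rep X).

Lemma weyl_char_conj P Q X : Q *m P = 1%:M -> weyl_char (P *m X *m Q) = weyl_char X.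
Proof.
move=> QP; rewrite /weyl_char !weyl_repM mxtrace_mulC mulmxA -weyl_repM QP.
by rewrite weyl_rep1 mul1mx.
Qed.

(** Each w_S is an eigenvector of a diagonal matrix, with the monomial of S as
    eigenvalue; passing from the basis w_S to the orthonormal one does not change
    the trace. *)
Lemma weyl_char_diag d :
  weyl_char (diag_mx d) = \sum_(S | ssyt S) \prod_b d 0 (S b).
Proof.
have [W WE] : exists W, weyl_onb = W *m weyl_mx.
  by apply/submxP; rewrite weyl_onb_eqmx.
pose W' := weyl_mx *m weyl_onb^t*.
have WW : W' *m W = 1%:M.
  apply: mulmx1C; rewrite mulmxA -WE; exact/unitarymxP/weyl_onb_unitary.
have act : weyl_mx *m tenspow (diag_mx d)
    = diag_mx (\row_(i < #|ssyt|) \prod_b d 0 ((enum_val i : filling) b)) *m weyl_mx.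
  apply/row_matrixP => i; rewrite row_mul rowK weyl_vec_diag.
  by apply/rowP => j; rewrite mul_diag_mx !mxE.
rewrite /weyl_char /weyl_rep {1}WE -!mulmxA (mulmxA weyl_mx) act -!mulmxA -/W' mxtrace_mulC.
rewrite -mulmxA WW mulmx1 mxtrace_diag.
rewrite (eq_bigr (fun i => \prod_b d 0 ((enum_val i : filling) b))); last first.
  by move=> i _; rewrite mxE.
by rewrite -(big_enum_val (A := ssyt) (fun S : filling => \prod_b d 0 (S b))).
Qed.

(** * The character depends only on the eigenvalues *)

Lemma weyl_charE X : weyl_char X = \sum_i \sum_(S : filling) \sum_(T : filling)
  weyl_onb i (enum_rank S) * (weyl_onb i (enum_rank T))^* * \prod_b X (S b) (T b).
Proof.
apply: eq_bigr => i _; rewrite mxE [RHS]exchange_big [RHS]sum_enum_val; apply: eq_bigr => q _.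
rewrite mxE mulr_suml [RHS]sum_enum_val; apply: eq_bigr => p _.
by rewrite !mxE !enum_valK mulrAC.
Qed.

(** Conjugation by diag(t^i) multiplies the (i, j) entry of a lower triangular
    matrix by t^(i - j).  The conjugates have the same character for t <> 0, the
    character is a polynomial in t, and t = 0 gives the diagonal part. *)
Lemma weyl_char_trig X : is_trig_mx X ->
  weyl_char X = weyl_char (diag_mx (\row_i X i i)).
Proof.
move=> /is_trig_mxP trigX; pose Xt (t : C) : 'M[C]_N := \matrix_(i, j) (X i j * t ^+ (i - j)).
pose p : {poly C} := \sum_i \sum_(S : filling) \sum_(T : filling)
  (weyl_onb i (enum_rank S) * (weyl_onb i (enum_rank T))^* * \prod_b X (S b) (T b))%:P
  * 'X^(\sum_b (S b - T b)).
have pE (t : C) : p.[t] = weyl_char (Xt t).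
  rewrite weyl_charE horner_sum; apply: eq_bigr => i _.
  rewrite horner_sum; apply: eq_bigr => S _; rewrite horner_sum; apply: eq_bigr => T _.
  rewrite hornerCM hornerXn -[LHS]mulrA; congr (_ * _).
  rewrite -prodrXr -big_split; apply: eq_bigr => b _.
  by rewrite mxE.
have Xt1 : Xt 1 = X by apply/matrixP => i j; rewrite mxE expr1n mulr1.
have Xt0 : Xt 0 = diag_mx (\row_i X i i).
  apply/matrixP => i j; rewrite !mxE expr0n subn_eq0 -val_eqE /=.
  case: ltngtP => [lt_ij|_|/val_inj->]; [|by rewrite mulr0|by rewrite mulr1].
  by rewrite trigX ?mul0r.
rewrite -Xt0 -!pE; apply/esym/poly_const_punctured => t t0; rewrite pE.
rewrite -(@weyl_char_conj (diag_mx (\row_i t ^+ i)) (diag_mx (\row_i t ^- i)) X).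
  congr weyl_char; apply/matrixP => i j; rewrite mul_mx_diag mul_diag_mx !mxE.
  case: (leqP j i) => [le_ji|lt_ij]; last by rewrite trigX // mulr0 !mul0r.
  by rewrite expfB_cond ?(negPf t0) // mulrCA mulrA.
apply/matrixP => i j; rewrite mul_diag_mx !mxE mulrnAr.
by rewrite mulVf ?expf_neq0.
Qed.

Lemma weyl_char_perm (s : 'S_N) (x : 'I_N -> C) :
  weyl_char (diag_mx (\row_i x (s i))) = weyl_char (diag_mx (\row_i x i)).
Proof.
rewrite -(@weyl_char_conj (perm_mx s) (perm_mx s^-1) (diag_mx (\row_i x i))).
  rewrite -row_permE -col_permE; congr weyl_char; apply/matrixP => i j.
  by rewrite !mxE (inj_eq perm_inj).
by rewrite -perm_mxM mulVg perm_mx1.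
Qed.

(** By unitary triangularization X is conjugate to a triangular matrix whose
    diagonal is a rearrangement of r; conjugation by a permutation matrix then
    absorbs the order. *)
Lemma weyl_char_eigenvalues (X : 'M[C]_N) (r : seq C) :
  char_poly X = \prod_(a <- r) ('X - a%:P) ->
  weyl_char X = \sum_(S | ssyt S) \prod_b r`_(S b).
Proof.
move=> charX; have size_r : size r = N.
  by apply/succn_inj; rewrite -(size_prod_XsubC r id) -charX size_char_poly.
transitivity (weyl_char (diag_mx (\row_(i < N) r`_i))); last first.
  rewrite weyl_char_diag; apply: eq_bigr => S _; apply: eq_bigr => b _.
  by rewrite mxE.
case: (posnP N) => [N0|N_gt0].
  by congr weyl_char; apply/matrixP => i; move: (ltn_ord i); rewrite {2}N0.
have [P Pu] := @Schur _ _ X N_gt0.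
rewrite /similar_to => trigY; have {trigY} : is_trig_mx (conjmx P X) by [].
rewrite conjymx //; set Y := P *m X *m _ => trigY.
have PP : P^t* *m P = 1%:M by apply/mulmx1C/unitarymxP.
rewrite -(weyl_char_conj X PP) -/Y weyl_char_trig //.
have : perm_eq r [tuple Y i i | i < N].
  apply: prod_XsubC_eq; rewrite -charX -(char_poly_similar X PP) -/Y.
  by rewrite char_poly_trig // big_map big_enum.
move/tuple_permP => [s rE].
rewrite -(weyl_char_perm s); congr (weyl_char (diag_mx _)); apply/rowP => i.
by rewrite [LHS]mxE [RHS]mxE rE -tnth_nth !tnth_mktuple.
Qed.

End WeylModule.

(** * Schur polynomials of matrices as sums of diagonal matrix coefficients *)

Lemma partition_nth_leq la i j : is_partition la -> (i <= j)%N ->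
  (j < size la)%N -> (nth 0%N la j <= nth 0%N la i)%N.
Proof.
move=> hla le_ij lt_j; apply: (@sorted_leq_nth _ geq) => // [x y w|x|].
- by move=> le1 le2; exact: leq_trans le2 le1.
- exact: leqnn.
- exact: leq_ltn_trans le_ij lt_j.
Qed.

Lemma box_inj la (a b : box la) : box_row a = box_row b -> box_col a = box_col b -> a = b.
Proof.
case: a b => [i j] [i' j']; rewrite /box_row /box_col /= => /val_inj eq_i.
by case: _ / eq_i j' => j' /val_inj ->.
Qed.

Lemma box_young la (b : box la) i j : is_partition la ->
  (i <= box_row b)%N -> (j <= box_col b)%N ->
  exists2 a : box la, box_row a = i & box_col a = j.
Proof.
move=> hla le_i le_j; have lt_i : (i < size la)%N by exact: leq_ltn_trans (ltn_ord (tag b)).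
have lt_j : (j < nth 0%N la i)%N.
  apply: leq_ltn_trans le_j (leq_trans (ltn_ord (tagged b)) _).
  exact: partition_nth_leq (ltn_ord (tag b)).
by exists (Tagged (fun i : 'I_(size la) => 'I_(nth 0%N la i)) (i := Ordinal lt_i) (Ordinal lt_j)).
Qed.

Section SchurGram.
Variable C : numClosedFieldType.

Lemma schur_mx_char (N : nat) (la : seq nat) (hla : is_partition la) (X : 'M[C]_N) :
  schur_mx la X = weyl_char (@box_row la) (@box_col la) X.
Proof.
rewrite (@weyl_char_eigenvalues _ _ _ (@box_inj la) (fun b i j => @box_young la b i j hla)
  C N X (eigenvalues X)) //.
rewrite /eigenvalues; case: closed_field_poly_normal => r /= {1}->.
by rewrite (monicP (char_poly_monic X)) scale1r.
Qed.

Lemma schur_mx_diag (N : nat) (la : seq nat) (hla : is_partition la) (d : 'rV[C]_N) :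
  schur_mx la (diag_mx d) = schur la (d 0).
Proof.
by rewrite schur_mx_char // weyl_char_diag //; exact: box_inj.
Qed.

(** The form in which the character is used: s_la is a sum of diagonal matrix
    coefficients of the tensor power indexed by the boxes. *)
Lemma schur_mx_gram (N : nat) (la : seq nat) (hla : is_partition la) :
  exists m (v : 'I_m -> {ffun box la -> 'I_N} -> C), forall X : 'M[C]_N,
    schur_mx la X = \sum_i \sum_S \sum_T v i S * (v i T)^* * \prod_b X (S b) (T b).
Proof.
exists _, (fun i S => weyl_onb (@box_row la) (@box_col la) C N i (enum_rank S)) => X.
by rewrite schur_mx_char // weyl_charE.
Qed.
End SchurGram.

(** * Mixed partial derivatives of products of affine functions *)

Import numFieldNormedType.Exports.

Section MixedPartial.
Variable C : numClosedFieldType.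

Lemma is_derive_horner (K : numFieldType) (p : {poly K}) (x : K) :
  is_derive x (1 : K) (horner p) p^`().[x].
Proof.
elim/poly_ind: p => [|p c IH].
  rewrite deriv0 horner0 (_ : horner 0 = cst 0); first exact: is_derive_cst.
  by apply/funext => y; rewrite horner0.
have -> : horner (p * 'X + c%:P) = horner p * id + cst c.
  by apply/funext => y; rewrite !hornerE.
apply: is_derive_eq; rewrite derivD derivC addr0 derivM derivX mulr1 !hornerE /=.
by rewrite [_%R *: _]mulr1 [_ *: _]mulrC addrC.
Qed.

Lemma derive1_horner (K : numFieldType) (p : {poly K}) (x : K) :
  derive1 (horner p) x = p^`().[x].
Proof. by rewrite derive1E; have [_ ->] := is_derive_horner p x. Qed.

(** Generalizes the computation of a mixed derivative to the successive stages
    of the iteration, in which only the variables of s have been differentiated. *)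
Lemma foldr_partial_monomials (I J : finType) (c : J -> C) (m : J -> I -> nat) (s : seq I) :
  uniq s ->
  foldr (@partial C I) (fun e => \sum_j c j * \prod_k e k ^+ m j k) s =
  (fun e => \sum_j c j * \prod_k
    (if k \in s then (m j k)%:R * e k ^+ (m j k).-1 else e k ^+ m j k)).
Proof.
elim: s => [//|a s IH] /andP[a_s /IH {}IH]; apply/funext => e.
rewrite [foldr _ _ _]/= IH /partial.
pose F j k := if k \in s then (m j k)%:R * e k ^+ (m j k).-1 else e k ^+ m j k.
pose p := \sum_j (c j * \prod_(k | k != a) F j k) *: 'X^(m j a).
have -> : (fun t => \sum_j c j * \prod_k
    (if k \in s then (m j k)%:R * (if k == a then t else e k) ^+ (m j k).-1
     else (if k == a then t else e k) ^+ m j k)) = horner p.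
  apply/funext => t; rewrite horner_sum; apply: eq_bigr => j _.
  rewrite hornerZ hornerXn -mulrA; congr (_ * _).
  rewrite (bigD1 a) //= (negPf a_s) eqxx mulrC; congr (_ * _).
  by apply: eq_bigr => k /negPf ->.
rewrite derive1_horner raddf_sum horner_sum; apply: eq_bigr => j _.
rewrite /= derivZ derivXn hornerZ hornerMn hornerXn -mulrA; congr (_ * _).
rewrite [RHS](bigD1 a) //= inE eqxx /= mulrC; congr (_ * _); first by rewrite mulr_natl.
by apply: eq_bigr => k /negPf ne_ka; rewrite inE ne_ka.
Qed.

Lemma mixed_partial0_monomials (I J : finType) (c : J -> C) (m : J -> I -> nat) :
  mixed_partial0 (fun e => \sum_j c j * \prod_k e k ^+ m j k)
  = \sum_j c j * \prod_k (m j k == 1)%:R.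
Proof.
rewrite /mixed_partial0 foldr_partial_monomials ?enum_uniq //.
apply: eq_bigr => j _; congr (_ * _); apply: eq_bigr => k _.
rewrite mem_enum; case: (m j k) => [|[|n]]; first by rewrite mul0r.
  by rewrite expr0 mulr1.
by rewrite expr0n mulr0.
Qed.

(** Expand the product: psi b tells whether the factor b contributes its
    constant term or its term in e k.  The mixed derivative at 0 keeps exactly the
    terms in which every variable is chosen once. *)
Lemma mixed_partial0_affine (I L B : finType) (w : L -> C)
    (alpha : L -> B -> C) (beta : L -> I -> B -> C) :
  mixed_partial0 (fun e => \sum_l w l * \prod_b (alpha l b + \sum_k e k * beta l k b))
  = \sum_(psi : {ffun B -> option I})
      (\prod_k (#|[pred b | psi b == Some k]| == 1)%:R) *
      \sum_l w l * \prod_b (if psi b is Some k then beta l k b else alpha l b).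
Proof.
have -> : (fun e : I -> C => \sum_l w l * \prod_b (alpha l b + \sum_k e k * beta l k b)) =
  (fun e => \sum_(j : L * {ffun B -> option I})
    (w j.1 * \prod_b (if j.2 b is Some k then beta j.1 k b else alpha j.1 b)) *
    \prod_k e k ^+ #|[pred b | j.2 b == Some k]|).
  apply/funext => e; rewrite -(pair_bigA _ (fun (l : L) (psi : {ffun B -> option I}) =>
    (w l * \prod_b (if psi b is Some k then beta l k b else alpha l b)) *
    \prod_k e k ^+ #|[pred b | psi b == Some k]|)) /=.
  apply: eq_bigr => l _.
  rewrite (eq_bigr (fun b => \sum_(o : option I)
    (if o is Some k then e k * beta l k b else alpha l b))); last first.
    by move=> b _; rewrite sum_option.
  rewrite bigA_distr_bigA mulr_sumr; apply: eq_bigr => psi _.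
  rewrite -mulrA; congr (_ * _).
  rewrite (eq_bigr (fun b => (if psi b is Some k then beta l k b else alpha l b) *
     \prod_(k | psi b == Some k) e k)); last first.
    move=> b _; case: (psi b) => [k|]; last by rewrite big_pred0 ?mulr1.
    by rewrite (big_pred1 k) 1?mulrC.
  rewrite big_split /=; congr (_ * _).
  rewrite (exchange_big_dep predT) //=; apply: eq_bigr => k _.
  by rewrite prodr_const.
rewrite mixed_partial0_monomials -(pair_bigA _ (fun l (psi : {ffun B -> option I}) =>
    (w l * \prod_b (if psi b is Some k then beta l k b else alpha l b)) *
    \prod_k (#|[pred b | psi b == Some k]| == 1)%:R)) /=.
rewrite exchange_big; apply: eq_bigr => psi _; rewrite mulr_sumr.
by apply: eq_bigr => l _; rewrite mulrC.
Qed.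
End MixedPartial.

(** * Positive matrices and operators acting on sites *)

Section Positivity.
Variable C : numClosedFieldType.

Lemma hermsymmx_entryP d (A : 'M[C]_d) :
  A \is hermsymmx <-> forall i j, A i j = (A j i)^*.
Proof.
split=> [/is_hermitianmxP hA i j|hA].
  by rewrite {1}hA expr0 scale1r !mxE.
by apply/is_hermitianmxP/matrixP => i j; rewrite expr0 scale1r !mxE hA.
Qed.

Lemma possemidef0 d : possemidef (0 : 'M[C]_d).
Proof.
split; first by apply/hermsymmx_entryP => i j; rewrite !mxE conjC0.
by move=> v; rewrite mulmx0 mul0mx mxE.
Qed.

Lemma possemidefD d (A A' : 'M[C]_d) :
  possemidef A -> possemidef A' -> possemidef (A + A').
Proof.
move=> [/hermsymmx_entryP hA pA] [/hermsymmx_entryP hA' pA']; split.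
  by apply/hermsymmx_entryP => i j; rewrite !mxE hA hA' rmorphD.
by move=> v; rewrite mulmxDr mulmxDl mxE addr_ge0.
Qed.

Lemma possemidefZ d (a : C) (A : 'M[C]_d) :
  0 <= a -> possemidef A -> possemidef (a *: A).
Proof.
move=> a_ge0 [/hermsymmx_entryP hA pA]; split.
  by apply/hermsymmx_entryP => i j; rewrite !mxE hA rmorphM /= (CrealP (ger0_real a_ge0)).
by move=> v; rewrite -scalemxAr -scalemxAl mxE mulr_ge0.
Qed.

Lemma possemidef_sum d (I : finType) (P : pred I) (F : I -> 'M[C]_d) :
  (forall i, P i -> possemidef (F i)) -> possemidef (\sum_(i | P i) F i).
Proof.
by move=> hF; apply: big_ind => //; [exact: possemidef0 | exact: possemidefD].
Qed.

Lemma possemidef_gram d (u : 'rV[C]_d) : possemidef (u^t* *m u).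
Proof.
split.
  by apply/hermsymmx_entryP => i j; rewrite !mxE !big_ord1 !mxE rmorphM /= conjCK mulrC.
move=> v; rewrite mulmxA -mulmxA; set x := u *m v.
have -> : v^t* *m u^t* = x^t* by rewrite /x trmx_mul map_mxM.
by rewrite mxE big_ord1 !mxE mulrC mul_conjC_ge0.
Qed.

(** Positive definiteness of T_la(t) comes from a single positive multiple of the
    identity added to a positive semidefinite operator. *)
Lemma posdef_add_scalar d (A : 'M[C]_d) (a : C) :
  possemidef A -> 0 < a -> posdef (a%:M + A).
Proof.
move=> [/hermsymmx_entryP hA pA] a_gt0; split.
  apply/hermsymmx_entryP => i j; rewrite !mxE hA rmorphD rmorphMn /=.
  by rewrite (CrealP (gtr0_real a_gt0)) eq_sym.
move=> v v_neq0; rewrite mulmxDr mulmxDl mxE ltr_pwDl // mul_mx_scalar.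
rewrite -scalemxAl mxE mulr_gt0 // mxE.
rewrite (eq_bigr (fun i => v i 0 * (v i 0)^*)); last first.
  by move=> i _; rewrite !mxE mulrC.
have [i v_i] : exists i, v i 0 != 0.
  apply/existsP; rewrite -negb_forall; apply: contra v_neq0 => /forallP v0.
  by apply/eqP/colP => i; rewrite mxE; apply/eqP.
rewrite (bigD1 i) //= ltr_pwDl ?mul_conjC_gt0 // sumr_ge0 // => j _.
exact: mul_conjC_ge0.
Qed.

Lemma siteE (N n : nat) (k : 'I_n) (A : 'M[C]_N) :
  site k A = tensmx (fun l => if l == k then A else 1%:M).
Proof.
apply/matrixP => p q; rewrite !mxE [RHS](bigD1 k) //= eqxx; congr (_ * _).
by apply: eq_bigr => l /negPf ->; rewrite mxE.
Qed.

(** A product of operators on distinct sites is a tensor product, whatever the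
    order of the factors. *)
Lemma prod_site (N n : nat) (s : seq 'I_n) (A : 'I_n -> 'M[C]_N) : uniq s ->
  \prod_(k <- s) site k (A k) = tensmx (fun l => if l \in s then A l else 1%:M).
Proof.
elim: s => [|a s IH] /=; first by rewrite big_nil; symmetry; exact: (@tensmx1 C 'I_n N).
move=> /andP[a_s /IH {}IH]; rewrite big_cons IH siteE.
apply: etrans (tensmxM _ _) _; congr tensmx; apply/funext => l.
rewrite inE; case: eqP => [->|_] /=; last by rewrite mul1mx.
by rewrite (negPf a_s) mulmx1.
Qed.

(** For given words, only one choice of the matrix units contributes to the entry:
    the summation over (i, j) in d_K collapses to that choice. *)
Lemma prod_site_delta (N n : nat) (K : {set 'I_n})
    (ij : {ffun {k : 'I_n | k \in K} -> 'I_N * 'I_N}) (p q : 'I_(tdim N n)) :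
  let a : {ffun 'I_n -> 'I_N} := enum_val p in
  let b : {ffun 'I_n -> 'I_N} := enum_val q in
  (\prod_k site (val k) (delta_mx (ij k).1 (ij k).2 : 'M[C]_N)) p q
  = (ij == [ffun k => (a (val k), b (val k))])%:R
    * \prod_(l | l \notin K) (a l == b l)%:R.
Proof.
move=> a b.
pose A l : 'M[C]_N :=
  if insub l is Some k then delta_mx (ij k).1 (ij k).2 else 1%:M.
have AE (k : {k | k \in K}) : A (val k) = delta_mx (ij k).1 (ij k).2.
  by rewrite /A valK.
rewrite (eq_bigr (fun k => site (val k) (A (val k)))); last by move=> k _; rewrite AE.
rewrite -(big_map (fun k : {k | k \in K} => val k) predT (fun l => site l (A l))).
rewrite prod_site ?map_inj_uniq ?index_enum_uniq //.
rewrite mxE -/a -/b.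
have inK l : (l \in [seq val k | k <- index_enum {k | k \in K}]) = (l \in K).
  apply/mapP/idP => [[k _ ->]|lK]; first exact: (valP k).
  by exists (Sub l lK); rewrite ?mem_index_enum.
rewrite (bigID (mem K)) /=; congr (_ * _); last first.
  by apply: eq_bigr => l /negPf lK; rewrite inK lK mxE.
have [ij_eq|ne_ij] := eqVneq ij [ffun k => (a (val k), b (val k))].
  rewrite big1 // => l lK; rewrite inK lK -[l]/(val (Sub l lK : {k | k \in K})) AE.
  by rewrite mxE ij_eq ffunE !eqxx.
have [k ne_k] : exists k, ij k != (a (val k), b (val k)).
  apply/existsP; rewrite -negb_forall; apply: contra ne_ij => /forallP eq_ij.
  by apply/eqP/ffunP => k; rewrite ffunE; apply/eqP.
rewrite (bigD1 (val k)) ?(valP k) //= inK (valP k) AE mxE.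
case: eqP => [e1|]; last by rewrite mul0r.
case: eqP => [e2|]; last by rewrite mul0r.
by case/eqP: ne_k; rewrite e1 e2 -surjective_pairing.
Qed.

End Positivity.

(** * Positivity of the derivatives of a Schur polynomial *)

Section GaudinPositivity.
Variables (C : numClosedFieldType) (N n : nat) (la : seq nat).
Hypothesis hla : is_partition la.
Variable d : 'rV[C]_N.
Local Notation filling := {ffun box la -> 'I_N}.
Local Notation word := {ffun 'I_n -> 'I_N}.

Section Site.
Variables (K : {set 'I_n}).
Local Notation site_of := {k : 'I_n | k \in K}.
Implicit Types (psi : {ffun box la -> option site_of}) (S T : filling) (a b : word).

(** The letters of S on the boxes that psi leaves free, over which the partial
    trace is taken. *)
Definition aux_residue psi S : {ffun box la -> option 'I_N} :=
  [ffun c => if psi c is Some _ then None else Some (S c)].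

(** The letters of a on the sites outside K, on which d_K acts as the identity. *)
Definition site_residue a : {ffun 'I_n -> option 'I_N} :=
  [ffun l => if l \in K then None else Some (a l)].

Definition aux_weight (m : {ffun box la -> option 'I_N}) : C :=
  \prod_c (if m c is Some x then d 0 x else 1).

(** Indicator that S agrees with a through the gluing psi of boxes to sites. *)
Definition aux_match psi S a : C :=
  \prod_c (if psi c is Some k then (S c == a (val k))%:R else 1).

Definition psi_mult psi : C :=
  \prod_k (#|[pred c | psi c == Some k]| == 1)%:R.

Lemma site_residueE a b :
  \prod_(l | l \notin K) (a l == b l)%:R = (site_residue a == site_residue b)%:R :> C.
Proof.
have [eq_ab|ne_ab] := eqVneq.
  apply: big1 => l /negPf lK; have /ffunP/(_ l) := eq_ab.
  by rewrite !ffunE lK => -[->]; rewrite eqxx.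
have [l ne_l] : exists l, site_residue a l != site_residue b l.
  apply/existsP; rewrite -negb_forall; apply: contra ne_ab => /forallP eq_ab.
  by apply/eqP/ffunP => l; apply/eqP.
move: ne_l; rewrite !ffunE; case: ifPn => [|lK ne_l]; first by rewrite eqxx.
rewrite (bigD1 l) //=; case: (a l =P b l) ne_l => [->|_ _]; first by rewrite eqxx.
by rewrite mul0r.
Qed.

(** The kernel obtained by differentiation separates: except for a diagonal term
    on the free boxes, S is coupled only to b and T only to a.  This separation is
    what produces Gram matrices. *)
Lemma aux_productE psi S T a b :
  \prod_c (if psi c is Some k then ((S c == b (val k)) && (T c == a (val k)))%:R
           else d 0 (S c) *+ (S c == T c))
  = (aux_residue psi S == aux_residue psi T)%:R * aux_weight (aux_residue psi S)
    * (aux_match psi S b * aux_match psi T a).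
Proof.
have [eq_ST|ne_ST] := eqVneq.
  rewrite mul1r -!big_split; apply: eq_bigr => c _ /=.
  have /ffunP/(_ c) := eq_ST; rewrite !ffunE; case: (psi c) => [k _|[->]].
    by rewrite mul1r -natrM mulnb.
  by rewrite eqxx !mulr1.
have [c ne_c] : exists c, aux_residue psi S c != aux_residue psi T c.
  apply/existsP; rewrite -negb_forall; apply: contra ne_ST => /forallP eq_ST.
  by apply/eqP/ffunP => c; apply/eqP.
move: ne_c; rewrite !ffunE (bigD1 c) //=; case: (psi c) => [k|]; first by rewrite eqxx.
by case: (S c =P T c) => [->|_ _]; rewrite ?eqxx //= ?mulr0n !mul0r.
Qed.

Lemma aux_match_real psi S a : (aux_match psi S a)^* = aux_match psi S a.
Proof.
rewrite rmorph_prod; apply: eq_bigr => c _.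
by case: (psi c) => [k|] /=; rewrite ?conjC_nat ?conjC1.
Qed.

(** Contraction of v with the word q through psi, the free boxes and the sites
    outside K having prescribed letters [mu] and [nu]. *)
Definition gram_vec m (v : 'I_m -> filling -> C) i psi
    (mu : {ffun box la -> option 'I_N}) (nu : {ffun 'I_n -> option 'I_N}) :
    'rV[C]_(tdim N n) :=
  \row_q \sum_S v i S * ((aux_residue psi S == mu)%:R *
    (site_residue (enum_val q) == nu)%:R * aux_match psi S (enum_val q)).

(** The partial trace over the free boxes is the sum over [mu], the identity on the
    sites outside K is the sum over [nu], and the trace on the Weyl module is the
    sum over i. *)
Lemma dK_gram m (v : 'I_m -> filling -> C) :
  (forall X : 'M[C]_N,
    schur_mx la X = \sum_i \sum_S \sum_T v i S * (v i T)^* * \prod_b X (S b) (T b)) ->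
  dK K (schur_mx la) (diag_mx d) =
  \sum_psi psi_mult psi *: \sum_mu aux_weight mu *: \sum_nu \sum_i
     (gram_vec v i psi mu nu)^t* *m gram_vec v i psi mu nu.
Proof.
move=> schurE; apply/matrixP => p q; rewrite !summxE.
pose a : word := enum_val p; pose b : word := enum_val q.
pose w (l : 'I_m * filling * filling) := v l.1.1 l.1.2 * (v l.1.1 l.2)^*.
transitivity (\sum_psi psi_mult psi * \sum_l w l *
   ((aux_residue psi l.1.2 == aux_residue psi l.2)%:R *
     aux_weight (aux_residue psi l.1.2)
    * (aux_match psi l.1.2 b * aux_match psi l.2 a))
   * (site_residue a == site_residue b)%:R).
  rewrite (bigD1 [ffun k => (a (val k), b (val k))]) //= [X in _ + X]big1 ?addr0; last first.
    by move=> ij ne_ij; rewrite mxE prod_site_delta (negPf ne_ij) mul0r mulr0.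
  rewrite mxE prod_site_delta eqxx mul1r -/a -/b site_residueE.
  set ij := finfun _.
  have -> : (fun e : site_of -> C => schur_mx la (diag_mx d
                + \sum_k e k *: delta_mx (ij k).2 (ij k).1)) =
     (fun e => \sum_l w l * \prod_c (d 0 (l.1.2 c) *+ (l.1.2 c == l.2 c)
        + \sum_k e k * ((l.1.2 c == b (val k)) && (l.2 c == a (val k)))%:R)).
    apply/funext => e; rewrite schurE pair_bigA pair_bigA; apply: eq_bigr => l _ /=.
    rewrite -mulrA /w -mulrA; congr (_ * (_ * _)); apply: eq_bigr => c _.
    rewrite !mxE summxE; congr (_ + _); apply: eq_bigr => k _.
    by rewrite !mxE ffunE.
  rewrite mixed_partial0_affine mulr_suml; apply: eq_bigr => psi _.
  rewrite -mulrA; congr (_ * _); rewrite mulr_suml; apply: eq_bigr => l _.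
  by rewrite aux_productE.
apply: eq_bigr => psi _; rewrite !mxE summxE; congr (_ * _).
have gramE mu nu : (\sum_i (gram_vec v i psi mu nu)^t* *m gram_vec v i psi mu nu) p q =
   \sum_l w l * ((aux_residue psi l.1.2 == mu)%:R * (aux_residue psi l.2 == mu)%:R) *
   ((site_residue a == nu)%:R * (site_residue b == nu)%:R) *
    (aux_match psi l.1.2 b * aux_match psi l.2 a).
  rewrite summxE -(pair_bigA _ (fun (iS : 'I_m * filling) (T : filling) => v iS.1 iS.2 * (v iS.1 T)^* *
    ((aux_residue psi iS.2 == mu)%:R * (aux_residue psi T == mu)%:R) *
    ((site_residue a == nu)%:R * (site_residue b == nu)%:R) *
    (aux_match psi iS.2 b * aux_match psi T a))) /=.
  rewrite -(pair_bigA _ (fun (i : 'I_m) (S : filling) => \sum_T v i S * (v i T)^* *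
    ((aux_residue psi S == mu)%:R * (aux_residue psi T == mu)%:R) *
    ((site_residue a == nu)%:R * (site_residue b == nu)%:R) *
    (aux_match psi S b * aux_match psi T a))) /=.
  apply: eq_bigr => i _; rewrite mxE big_ord1 !mxE mulrC mulr_suml.
  apply: eq_bigr => S _; rewrite rmorph_sum mulr_sumr; apply: eq_bigr => T _.
  rewrite !rmorphM /= !conjC_nat aux_match_real -/a -/b; ring.
under [RHS]eq_bigr => mu _.
  rewrite mxE summxE.
  have -> : \sum_nu (\sum_i (gram_vec v i psi mu nu)^t* *m gram_vec v i psi mu nu) p q =
     \sum_l w l * ((aux_residue psi l.1.2 == mu)%:R * (aux_residue psi l.2 == mu)%:R) *
       (aux_match psi l.1.2 b * aux_match psi l.2 a) * (site_residue a == site_residue b)%:R.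
    under eq_bigr do rewrite gramE.
    rewrite exchange_big; apply: eq_bigr => l _ /=.
    rewrite -(mulr1 (_ == site_residue b)%:R) -(sum_eq_indicators (fun=> 1)) mulr_sumr.
    by apply: eq_bigr => nu _; ring.
  rewrite mulr_sumr.
  over.
rewrite /= [RHS]exchange_big; apply: eq_bigr => l _ /=.
rewrite -(sum_eq_indicators aux_weight) mulr_suml mulr_sumr mulr_suml.
by apply: eq_bigr => mu _; ring.
Qed.

Lemma possemidef_dK : (forall i, 0 <= d 0 i) ->
  possemidef (dK K (schur_mx la) (diag_mx d)).
Proof.
move=> d_ge0; have [m [v schurE]] := schur_mx_gram C N hla.
rewrite (dK_gram schurE); apply: possemidef_sum => psi _; apply: possemidefZ.
  by apply: prodr_ge0 => k _; exact: ler0n.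
apply: possemidef_sum => mu _; apply: possemidefZ.
  by apply: prodr_ge0 => c _; case: (mu c).
apply: possemidef_sum => nu _; apply: possemidef_sum => i _.
exact: possemidef_gram.
Qed.
End Site.

Lemma dK_set0 (f : 'M[C]_N -> C) (h : 'M[C]_N) : dK (set0 : {set 'I_n}) f h = (f h)%:M.
Proof.
have no_site (k : {k : 'I_n | k \in set0}) : False by case: k => k; rewrite inE.
pose ij0 : {ffun {k : 'I_n | k \in set0} -> 'I_N * 'I_N} :=
  [ffun k => False_rect _ (no_site k)].
rewrite /dK (bigD1 ij0) //= [X in _ + X]big1 ?addr0; last first.
  by move=> ij /eqP[]; apply/ffunP => k; case: (no_site k).
rewrite /mixed_partial0 (_ : enum _ = [::]); last first.
  by case: (enum _) => // k; case: (no_site k).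
rewrite /= !big1 ?addr0 => [||k]; last 2 first.
- by move=> k; case: (no_site k).
- by case: (no_site k).
by rewrite scalemx1.
Qed.

Lemma gaudin_atE (h : 'M[C]_N) (z : 'I_n -> C) t :
  gaudin_at la h z t =
  \sum_(K : {set 'I_n}) (\prod_(k in ~: K) (t + z k)) *: dK K (schur_mx la) h.
Proof.
apply/matrixP => p q; rewrite !mxE summxE /horner_eval horner_sum summxE.
apply: eq_bigr => K _; rewrite !mxE hornerM hornerC horner_prod; congr (_ * _).
by apply: eq_bigr => k _; rewrite hornerD hornerX hornerC.
Qed.

Lemma possemidef_gaudin (z : 'I_n -> C) t :
  (forall i, 0 <= d 0 i) -> (forall k, 0 <= t + z k) ->
  possemidef (gaudin_at la (diag_mx d) z t).
Proof.
move=> d_ge0 z_ge0; rewrite gaudin_atE; apply: possemidef_sum => K _.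
by apply: possemidefZ; [apply: prodr_ge0 => k _ | apply: possemidef_dK].
Qed.

Lemma posdef_gaudin (z : 'I_n -> C) t :
  (forall i, 0 <= d 0 i) -> 0 < schur la (d 0) -> (forall k, 0 < t + z k) ->
  posdef (gaudin_at la (diag_mx d) z t).
Proof.
move=> d_ge0 s_gt0 z_gt0; rewrite gaudin_atE (bigD1 set0) //= dK_set0 schur_mx_diag //.
rewrite scale_scalar_mx; apply: posdef_add_scalar.
  apply: possemidef_sum => K _; apply: possemidefZ; last exact: possemidef_dK.
  by apply: prodr_ge0 => k _; exact: ltW.
by rewrite mulr_gt0 // prodr_gt0.
Qed.
End GaudinPositivity.

(** * Positivity of Schur polynomials *)

Lemma nth_lt_nparts la r : is_partition la -> (0 < nth 0%N la r)%N -> (r < nparts la)%N.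
Proof.
move=> hla r_gt0; have lt_r : (r < size la)%N.
  by rewrite ltnNge; apply: contraTN r_gt0 => le_r; rewrite nth_default.
rewrite /nparts -(cat_take_drop r.+1 la) count_cat.
suff : (count (fun p => 0 < p)%N (take r.+1 la) == r.+1)%N by move/eqP->; exact: leq_addr.
rewrite -{2}(size_takel lt_r) -all_count; apply/(all_nthP 0%N) => i.
rewrite size_takel // ltnS => le_ir; rewrite nth_take //.
exact: leq_trans r_gt0 (partition_nth_leq hla le_ir lt_r).
Qed.

Lemma ltn_enum_val N (P : pred 'I_N) (i j : 'I_#|P|) :
  (i < j)%N -> (enum_val i < enum_val j)%N.
Proof.
have [x0 _] : exists x0 : 'I_N, true by exists (enum_val i).
rewrite !(enum_val_nth x0) => lt_ij.
apply: (@sorted_ltn_nth _ (relpre val ltn)) => //; try by rewrite inE -cardE.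
- by move=> x y z; exact: ltn_trans.
- rewrite /enum_mem sorted_filter //; first by move=> x y z; exact: ltn_trans.
  by rewrite -sorted_map -enumT val_enum_ord iota_ltn_sorted.
Qed.

(** The tableau which is constant along rows, its r-th row being filled with the
    r-th index at which x is positive, has positive weight, and no tableau has a
    negative one. *)
Lemma schur_gt0 (F : numDomainType) (N : nat) (la : seq nat) (x : 'I_N -> F) :
  is_partition la -> (forall i, 0 <= x i) ->
  (nparts la <= #|[pred i | (0 < x i)%R]|)%N -> 0 < schur la x.
Proof.
move=> hla x_ge0 le_parts; set P := [pred i | _] in le_parts.
have row_lt (b : box la) : (box_row b < #|P|)%N.
  apply: leq_trans le_parts; apply: nth_lt_nparts => //.
  exact: leq_ltn_trans (leq0n _) (ltn_ord (tagged b)).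
pose S : {ffun box la -> 'I_N} := [ffun b => enum_val (Ordinal (row_lt b))].
have sS : semistandard S.
  apply/forallP => a; apply/forallP => b; rewrite !ffunE.
  apply/andP; split; apply/implyP => /andP[/eqP eq_ab lt_ab].
    by rewrite (_ : Ordinal _ = Ordinal (row_lt b)) //; apply/val_inj.
  exact: ltn_enum_val.
rewrite /schur (bigD1 S) //= ltr_pwDl //.
  by apply: prodr_gt0 => b _; rewrite ffunE; have := enum_valP (Ordinal (row_lt b)).
by apply: sumr_ge0 => T _; apply: prodr_ge0.
Qed.

Local Open Scope complex_scope.

Theorem theorem6p4 (R : realType) (N n : nat) (la : seq nat)
    (hla : is_partition la) (h : 'I_N -> R) (z : 'I_n -> R) :
  let H : 'M[R[i]]_N := diag_mx (\row_i (h i)%:C) in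
  let T (t : R) := gaudin_at la H (fun k => (z k)%:C) t%:C in
  ((forall i, 0 <= h i) ->
     forall t : R, (forall k, - z k <= t) -> possemidef (T t))
  /\
  ((forall i, 0 <= h i) -> (nparts la <= #|[pred i | (0 < h i)%R]|)%N ->
     forall t : R, (forall k, - z k < t) -> posdef (T t)).
Proof.
move=> H T; split=> [h_ge0 t z_ge|h_ge0 le_parts t z_gt].
  apply: possemidef_gaudin => // [i|k]; first by rewrite mxE lecR.
  by rewrite -rmorphD lecR -lerBlDr sub0r.
apply: posdef_gaudin => // [i||k]; first by rewrite mxE lecR.
  apply: schur_gt0 => // [i|]; first by rewrite mxE lecR.
  apply: leq_trans le_parts _; apply/subset_leq_card/subsetP => i.
  by rewrite !inE mxE ltcR.
by rewrite -rmorphD ltcR -ltrBlDr sub0r.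
Qed.
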